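(* Let $p$ be a prime. The finitely generated abelian groups that occur (up to isomorphism) as groups of units of an integral domain of characteristic $p$ are exactly the groups of the form $\mathbb{F}_{p^n}^*\times\mathbb{Z}^g$ with integers $n\ge1$ and $g\ge0$.
   Context: $\mathbb{F}_q$ denotes the field with $q$ elements and $\mathbb{F}_q^*$ its multiplicative group. *)

(* Defs.v *)
From HB Require Import structures.
From mathcomp Require Import all_boot all_order all_fingroup all_algebra.
From mathcomp Require Import all_solvable all_field.

Set Implicit Arguments.
Unset Strict Implicit.
Unset Printing Implicit Defensive.

Import GRing.Theory.
Local Open Scope ring_scope.

(* Abelian groups are zmodTypes, hence written additively.  The group of units
   of a commutative ring is therefore a zmodType whose "addition" is the
   multiplication of the ring.  The library's {unit R} covers finite rings
   only. *)
Record units (R : comUnitRingType) := Units {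
  units_val :> R;
  units_valP : units_val \is a GRing.unit
}.

Section Units.
Variable R : comUnitRingType.
Implicit Types u v w : units R.

HB.instance Definition _ := [isSub for @units_val R].
HB.instance Definition _ := [Choice of units R by <:].

Fact units_add_proof u v : val u * val v \is a GRing.unit.
Proof. by rewrite unitrMl (valP u, valP v). Qed.

Fact units_opp_proof u : (val u)^-1 \is a GRing.unit.
Proof. by rewrite unitrV (valP u). Qed.

Definition units_zero : units R := Units (unitr1 R).
Definition units_add u v : units R := Units (units_add_proof u v).
Definition units_opp u : units R := Units (units_opp_proof u).

Fact units_addA : associative units_add.
Proof. by move=> u v w; apply: val_inj; rewrite /= mulrA. Qed.

Fact units_addC : commutative units_add.
Proof. by move=> u v; apply: val_inj; rewrite /= mulrC. Qed.

Fact units_add0 : left_id units_zero units_add.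
Proof. by move=> u; apply: val_inj; rewrite /= mul1r. Qed.

Fact units_addN : left_inverse units_zero units_opp units_add.
Proof. by move=> u; apply: val_inj; rewrite /= mulVr ?(valP u). Qed.

HB.instance Definition _ :=
  GRing.isZmodule.Build (units R) units_addA units_addC units_add0 units_addN.

End Units.

Definition fin_gen (A : zmodType) : Prop :=
  exists (k : nat) (s : 'I_k -> A), forall x : A,
    exists c : 'I_k -> int, x = \sum_(i < k) s i *~ c i.

Definition isomorphic (A B : zmodType) : Prop :=
  exists f : {additive A -> B}, bijective f.

(* #|Fpn _ _| = p ^ n is part of the specification of pPrimePowerField; a field
   with p ^ n elements is unique up to isomorphism. *)
Definition Fpn (p n : nat) (pr_p : prime p) (n_gt0 : (0 < n)%N) : finFieldType :=
  s2val (pPrimePowerField pr_p n_gt0).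

(* Main.v *)
(* The units of a domain [R] of characteristic p that are torsion form, together
   with 0, an additive group: they are the fixed points of a power of the
   Frobenius endomorphism.  If they are finite in number, Cauchy's theorem gives
   that this group has p^n elements, so the torsion units form a cyclic group of
   order p^n - 1, like the units of the field with p^n elements.  Since a
   finitely generated abelian group is the direct sum of its finite torsion
   subgroup and of a free group, this settles one direction.  Conversely, the
   units of the Laurent polynomials over a domain are the monomials with unit
   coefficients, so g successive Laurent extensions of the field with p^n
   elements give a domain whose unit group has an extra factor Z^g. *)
Require Import Defs.
From HB Require Import structures.
From mathcomp Require Import all_boot all_order all_fingroup all_algebra.
From mathcomp Require Import all_solvable all_field.
From mathcomp Require Import boolp.

Set Implicit Arguments.
Unset Strict Implicit.
Unset Printing Implicit Defensive.

Import GRing.Theory Num.Theory.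
Local Open Scope ring_scope.

(** * Integer combinations of a family in an abelian group *)

Section Combinations.
Variables (A : zmodType) (g : nat).
Implicit Types (z : 'I_g -> A) (c d : 'rV[int]_g).

(** The coefficients form a row vector so that integer matrices can act on them. *)
Definition intcomb z c : A := \sum_i z i *~ c 0 i.

Lemma intcombD z c d : intcomb z (c + d) = intcomb z c + intcomb z d.
Proof. by rewrite -big_split; apply: eq_bigr => i _; rewrite mxE mulrzDr. Qed.

Lemma intcomb0 z : intcomb z 0 = 0.
Proof. by rewrite /intcomb big1 // => i _; rewrite mxE mulr0z. Qed.

Lemma intcombB z c d : intcomb z (c - d) = intcomb z c - intcomb z d.
Proof. by rewrite -sumrB; apply: eq_bigr => i _; rewrite !mxE mulrzBr. Qed.

Lemma intcombMn z c n : intcomb z (c *+ n) = intcomb z c *+ n.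
Proof. by elim: n => [|n IHn]; rewrite ?intcomb0 // !mulrS intcombD IHn. Qed.

Lemma intcomb_mulmx n z (c : 'rV_n) (U : 'M_(n, g)) :
  intcomb z (c *m U) = \sum_i intcomb z (row i U) *~ c 0 i.
Proof.
rewrite [LHS](eq_bigr (fun j => \sum_i z j *~ U i j *~ c 0 i)) => [|j _].
  rewrite exchange_big; apply: eq_bigr => i _; rewrite mulrz_suml.
  by apply: eq_bigr => j _; rewrite mxE.
by rewrite mxE mulrz_sumr; apply: eq_bigr => i _; rewrite -mulrzA mulrC.
Qed.

End Combinations.

Lemma raddf_intcomb (A B : zmodType) (f : {additive A -> B}) g (z : 'I_g -> A)
    (c : 'rV_g) :
  f (intcomb z c) = intcomb (f \o z) c.
Proof. by rewrite raddf_sum; apply: eq_bigr => i _; rewrite raddfMz. Qed.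

Lemma intcomb_row_mx (A : zmodType) g h (z : 'I_(g + h) -> A)
    (c : 'rV_g) (d : 'rV_h) :
  intcomb z (row_mx c d)
    = intcomb (z \o lshift h) c + intcomb (z \o @rshift g h) d.
Proof.
rewrite /intcomb big_split_ord; congr (_ + _); apply: eq_bigr => i _ /=.
  by rewrite row_mxEl.
by rewrite row_mxEr.
Qed.

(** * Groups presented by a cyclic generator and a free family *)

(* [A] is the internal direct sum of a cyclic group of order [m] (generated by
   [a]) and of a free group of rank [g] (with basis [z]). *)
Definition presentation (A : zmodType) m g a (z : 'I_g -> A) :=
  (forall x, exists u : int * 'rV_g, x == a *~ u.1 + intcomb z u.2) /\
  (forall k c, a *~ k + intcomb z c = 0 <-> (m %| k)%Z /\ c = 0).

Definition presented (A : zmodType) m g :=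
  exists a (z : 'I_g -> A), presentation m a z.

(** Both groups have the same relations, so two coordinate pairs have equal values in [A] iff they
    do in [B]; hence choosing coordinates in [A] and evaluating them in [B] is well defined. The
    boolean equality in [presentation] is what allows [xchoose]. *)
Lemma presented_isomorphic (A B : zmodType) m g :
  presented A m g -> presented B m g -> isomorphic A B.
Proof.
move=> [a [z [gena rela]]] [b [w [genb relb]]].
pose val (C : zmodType) (x : C) y (u : int * 'rV[int]_g) : C :=
  x *~ u.1 + intcomb y u.2.
have valB C x y u v : @val C x y (u - v) = val C x y u - val C x y v.
  by rewrite /val mulrzBr intcombB opprD addrACA.
have valE u v : (val _ a z u == val _ a z v) = (val _ b w u == val _ b w v).
  rewrite -subr_eq0 -valB -[RHS]subr_eq0 -valB.
  by apply/eqP/eqP=> [/rela/relb | /relb/rela].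
pose f x := val _ b w (xchoose (gena x)).
pose h y := val _ a z (xchoose (genb y)).
have fP u : f (val _ a z u) = val _ b w u.
  by apply/eqP; rewrite -valE eq_sym (xchooseP (gena _)).
have hP u : h (val _ b w u) = val _ a z u.
  by apply/eqP; rewrite valE eq_sym (xchooseP (genb _)).
have fB : zmod_morphism f.
  move=> x y; have [[u /eqP->] [v /eqP->]] := (gena x, gena y).
  by rewrite -![_ *~ _ + _]/(val _ a z _) -valB !fP valB.
pose fA := GRing.isZmodMorphism.Build _ _ f fB.
exists (HB.pack f fA : {additive A -> B}); exists h => [x | y] /=.
  by have [u /eqP->] := gena x; rewrite -[_ *~ _ + _]/(val _ a z _) fP hP.
by have [u /eqP->] := genb y; rewrite -[_ *~ _ + _]/(val _ b w _) hP fP.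
Qed.

Lemma isomorphic_presented (A B : zmodType) m g :
  isomorphic A B -> presented B m g -> presented A m g.
Proof.
move=> [f [h fK hK]] [b [w [genb relb]]]; exists (h b), (h \o w).
have fE k c : f (h b *~ k + intcomb (h \o w) c) = b *~ k + intcomb w c.
  rewrite raddfD raddfMz raddf_intcomb /= hK; congr (_ + _).
  by apply: eq_bigr => i _; rewrite /= hK.
split=> [x | k c].
  have [u /eqP fx] := genb (f x); exists u; apply/eqP/(can_inj fK).
  by rewrite fE.
by rewrite -relb -fE; split=> [-> | /eqP]; rewrite ?raddf0 // raddf_eq0;
   [move/eqP | apply: can_inj fK].
Qed.

Lemma presented_fin_gen (A : zmodType) m g : presented A m g -> fin_gen A.
Proof.
move=> [a [z [gena _]]].
exists (1 + g)%N, (fun i => if split i is inr j then z j else a) => x.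
have [u /eqP->] := gena x; exists (row_mx (const_mx u.1) u.2 0).
rewrite -[RHS]/(intcomb _ _) intcomb_row_mx /intcomb big_ord1 mxE.
congr (_ + _); first by rewrite /= (unsplitK (inl _)).
by apply: eq_bigr => i _; rewrite /= (unsplitK (inr _)).
Qed.

(** The two hypotheses make [B] the direct sum of an injective image of [A] and of the infinite
    cyclic group generated by [y], which joins the basis. *)
Lemma presented_extend (A B : zmodType) (f : {additive A -> B}) (y : B) m g :
    (forall b, exists (x : A) (k : int), b = f x + y *~ k) ->
    (forall x k, f x + y *~ k = 0 -> x = 0 /\ k = 0) ->
  presented A m g -> presented B m (g + 1).
Proof.
move=> genB relB [a [z [gena rela]]].
exists (f a), (fun i => if split i is inl j then f (z j) else y).
have valE k c (d : 'rV_1) :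
    f a *~ k + intcomb (fun i => if split i is inl j then f (z j) else y)
                       (row_mx c d)
      = f (a *~ k + intcomb z c) + y *~ d 0 0.
  rewrite intcomb_row_mx addrA raddfD raddfMz raddf_intcomb; congr (_ + _ + _).
    by apply: eq_bigr => i _; rewrite /= (unsplitK (inl _)).
  by rewrite /intcomb big_ord1 /= (unsplitK (inr _)).
split=> [b | k c].
  have [x [l ->]] := genB b; have [u /eqP->] := gena x.
  by exists (u.1, row_mx u.2 (const_mx l)); rewrite valE mxE.
rewrite -[c]hsubmxK valE; split=> [/relB[/rela[mk ->] r0] | [mk /eqP]].
  split=> //; rewrite (_ : rsubmx c = 0) ?row_mx0 //.
  by apply/rowP=> i; rewrite ord1 r0 mxE.
rewrite row_mx_eq0 => /andP[/eqP-> /eqP->]; rewrite mxE mulr0z addr0.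
by rewrite (proj2 (rela k 0)) ?raddf0.
Qed.

Lemma presented_prod_free (A : zmodType) m g :
  presented A m 0 -> presented (A * 'rV[int]_g)%type m g.
Proof.
move=> [a [z [gena rela]]].
have z0 c : intcomb z c = 0 by rewrite /intcomb big_ord0.
exists (a, 0), (fun i => (0, delta_mx 0 i)).
have valE k c : (a, 0) *~ k + intcomb (fun i => (0, delta_mx 0 i)) c
    = (a *~ k, c) :> A * 'rV[int]_g.
  rewrite [RHS]surjective_pairing; apply/eqP; rewrite -pair_eqE /=.
  have fE : fst ((a, 0 : 'rV[int]_g) *~ k) = a *~ k by rewrite raddfMz.
  have sE : snd ((a, 0 : 'rV[int]_g) *~ k) = 0 by rewrite raddfMz mul0rz.
  rewrite fE sE add0r !raddf_intcomb /intcomb big1 => [|i _]; last exact: mul0rz.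
  rewrite addr0 eqxx [eqbRHS]row_sum_delta; apply/eqP/eq_bigr => i _ /=.
  by rewrite -[c 0 i in RHS]intz scaler_int.
split=> [[x c] | k c].
  have [u /eqP xE] := gena x; exists (u.1, c); rewrite valE /=.
  by rewrite xE z0 addr0.
rewrite valE; have := rela k 0; rewrite intcomb0 addr0 => ak.
split=> [[/ak[mk _] ->] // | [mk ->]].
by congr (_, _); apply/ak.
Qed.

(** * Laurent polynomials over a domain and their units *)

Lemma units_valD (R : comUnitRingType) (u v : units R) :
  val (u + v) = val u * val v.
Proof. by []. Qed.

Lemma units_valMn (R : comUnitRingType) (u : units R) n :
  val (u *+ n) = val u ^+ n.
Proof. by elim: n => // n IHn; rewrite mulrS exprS -IHn. Qed.

(** For positive [n] one of the factors vanishes at 0, because [R] is a domain; it is divisible by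
    ['X], which is cancelled before applying induction. *)
Lemma mul_eq_polyXn (R : idomainType) n (f h : {poly R}) :
    f * h = 'X^n ->
  exists c k, c \is a GRing.unit /\ f = c%:P * 'X^k.
Proof.
elim: n f h => [|n IHn] f h fh.
  have: f \is a GRing.unit by apply/unitrPr; exists h.
  rewrite poly_unitE => /andP[/eqP sf uf].
  have /size1_polyC fE: (size f <= 1)%N by rewrite sf.
  by exists f`_0, 0%N; split; rewrite ?mulr1.
have XI : injective (fun q : {poly R} => 'X * q).
  by apply: mulfI; rewrite polyX_eq0.
have /eqP: (f * h).[0] = 0 by rewrite fh hornerXn expr0n.
rewrite hornerM mulf_eq0 => /orP[] /factor_theorem[q].
  rewrite subr0 mulrC => fE; have [|c [k [uc qE]]] := IHn q h.
    by apply: XI; rewrite mulrA -fE fh exprS.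
  by exists c, k.+1; rewrite fE qE exprS mulrCA.
rewrite subr0 mulrC => hE; have [|c [k [uc fE]]] := IHn f q.
  by apply: XI; rewrite mulrCA -hE fh exprS.
by exists c, k.
Qed.

Section Laurent.
Variable R : idomainType.
Local Notation K := {fraction {poly R}}.
Local Notation "x %:F" := (tofrac x).

Definition fracX : K := 'X%:F.

Lemma fracX_neq0 : fracX != 0.
Proof. by rewrite tofrac_eq0 polyX_eq0. Qed.

(** Laurent polynomials are carved out of the fraction field of [{poly R}], from which they inherit
    commutativity and integrality. *)
Definition is_laurent : {pred K} :=
  fun x => `[< exists n (f : {poly R}), x * fracX ^+ n = f%:F >].

Lemma laurentP x :
  reflect (exists n (f : {poly R}), x * fracX ^+ n = f%:F) (x \in is_laurent).
Proof. exact: asboolP. Qed.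

Lemma laurent_tofrac f : f%:F \in is_laurent.
Proof. by apply/laurentP; exists 0%N, f; rewrite mulr1. Qed.

Fact laurent_subring : subring_closed is_laurent.
Proof.
split=> [|x y /laurentP[n [f xE]] /laurentP[m [h yE]]|
          x y /laurentP[n [f xE]] /laurentP[m [h yE]]].
- exact: (laurent_tofrac 1).
- apply/laurentP; exists (n + m)%N, (f * 'X^m - h * 'X^n).
  rewrite tofracB !tofracM !tofracXn -xE -yE exprD mulrBl -!mulrA.
  by rewrite [_ ^+ m * _]mulrC.
apply/laurentP; exists (n + m)%N, (f * h).
by rewrite tofracM -xE -yE exprD mulrACA.
Qed.

HB.instance Definition _ :=
  GRing.isSubringClosed.Build K is_laurent laurent_subring.

Record laurent := Laurent { laurent_val : K; _ : laurent_val \in is_laurent }.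

HB.instance Definition _ := [isSub for laurent_val].
HB.instance Definition _ := [Choice of laurent by <:].
HB.instance Definition _ := [SubChoice_isSubComNzRing of laurent by <:].

Lemma laurent_valM (x y : laurent) : val (x * y) = val x * val y.
Proof. exact: rmorphM. Qed.

Definition laurent_unit : {pred laurent} :=
  fun x => (val x != 0) && ((val x)^-1 \in is_laurent).
Definition laurent_inv (x : laurent) : laurent :=
  if x \in laurent_unit then insubd x (val x)^-1 else x.

Fact laurent_mulVx : {in laurent_unit, left_inverse 1 laurent_inv *%R}.
Proof.
move=> x ux; have /andP[x0 Vx] := ux; apply: val_inj.
by rewrite laurent_valM /laurent_inv ux insubdK // mulVf.
Qed.

Fact laurent_unitPl (x y : laurent) : y * x = 1 -> laurent_unit x.
Proof.
move/(congr1 val); rewrite laurent_valM => yx.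
have x0 : val x != 0.
  by apply: contra_eq_neq yx => ->; rewrite mulr0 eq_sym oner_eq0.
rewrite /laurent_unit x0 (_ : (val x)^-1 = val y) ?(valP y) //.
by apply: (mulIf x0); rewrite mulVf // yx.
Qed.

Fact laurent_inv_out : {in [predC laurent_unit], laurent_inv =1 id}.
Proof. by move=> x ux; rewrite /laurent_inv (negPf ux). Qed.

HB.instance Definition _ := GRing.ComNzRing_hasMulInverse.Build laurent
  laurent_mulVx laurent_unitPl laurent_inv_out.

Lemma laurent_unitE (x : laurent) :
  (x \is a GRing.unit) = (val x != 0) && ((val x)^-1 \in is_laurent).
Proof. by []. Qed.

Fact laurent_integral : GRing.integral_domain_axiom laurent.
Proof.
move=> x y /(congr1 val)/eqP; rewrite laurent_valM mulf_eq0.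
by rewrite -!(inj_eq val_inj).
Qed.

HB.instance Definition _ :=
  GRing.ComUnitRing_isIntegral.Build laurent laurent_integral.

Definition laurent_poly (f : {poly R}) : laurent := Laurent (laurent_tofrac f).

Fact laurent_poly_zmod : zmod_morphism laurent_poly.
Proof. by move=> f h; apply: val_inj; rewrite rmorphB /= rmorphB. Qed.

Fact laurent_poly_monoid : monoid_morphism laurent_poly.
Proof.
by split=> [|f h]; apply: val_inj; rewrite ?rmorphM ?rmorph1 /= ?rmorphM ?rmorph1.
Qed.

HB.instance Definition _ :=
  GRing.isZmodMorphism.Build {poly R} laurent laurent_poly laurent_poly_zmod.
HB.instance Definition _ :=
  GRing.isMonoidMorphism.Build {poly R} laurent laurent_poly laurent_poly_monoid.

Lemma laurent_polyM f h : laurent_poly (f * h) = laurent_poly f * laurent_poly h.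
Proof. exact: rmorphM. Qed.

Lemma laurent_poly_inj : injective laurent_poly.
Proof. by move=> f h /(congr1 val)/eqP; rewrite tofrac_eq => /eqP. Qed.

Lemma laurentX_unit : laurent_poly 'X \is a GRing.unit.
Proof.
apply/andP; split; first exact: fracX_neq0.
by apply/laurentP; exists 1%N, 1; rewrite mulVf ?fracX_neq0 ?rmorph1.
Qed.

Definition unitX : units laurent := Units laurentX_unit.

Definition laurent_const (u : units R) : units laurent :=
  Units (rmorph_unit (laurent_poly \o polyC) (units_valP u)).

Fact laurent_const_zmod : zmod_morphism laurent_const.
Proof.
move=> u v; apply: val_inj.
by rewrite /= !rmorphM /= !rmorphV ?(units_valP v) //= rmorph_unit ?(units_valP v).
Qed.

HB.instance Definition _ := GRing.isZmodMorphism.Build (units R) (units laurent)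
  laurent_const laurent_const_zmod.

(** If [v * X^n = f] and [v^-1 * X^m = h] with [f], [h] polynomials, then [f * h = X^(n + m)]; so
    [f = c * X^k] with [c] a unit, and [v = c * X^(k - n)]. *)
Lemma units_laurent_decomp (v : units laurent) :
  exists (u : units R) (k : int), v = laurent_const u + unitX *~ k.
Proof.
have := units_valP v; rewrite laurent_unitE => /andP[v0 /laurentP[m [h hE]]].
have /laurentP[n [f fE]] := valP (units_val v).
have [|c [k [uc fcX]]] := @mul_eq_polyXn R (n + m) f h.
  apply/eqP; rewrite -tofrac_eq tofracM tofracXn -fE -hE mulrACA.
  by rewrite divff // mul1r exprD.
exists (Units uc), (k%:Z - n%:Z); rewrite mulrzBr addrA.
(* Moving [unitX *~ n] to the other side leaves only natural exponents. *)
apply/eqP; rewrite eq_sym subr_eq eq_sym; apply/eqP.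
have valXn j : val (unitX *+ j) = laurent_poly 'X^j by rewrite units_valMn -rmorphXn.
apply: val_inj; rewrite !units_valD !valXn.
rewrite [val (laurent_const _)]/(laurent_poly c%:P) -laurent_polyM -fcX.
by apply: val_inj; rewrite laurent_valM [val (laurent_poly 'X^n)]tofracXn.
Qed.

(** For [k = n - m] the relation reads [u * X^n = X^m] in [{poly R}]; the coefficient of [X^m]
    forces [n = m] and [u = 1]. *)
Lemma units_laurent_free (u : units R) (k : int) :
  laurent_const u + unitX *~ k = 0 -> u = 0 /\ k = 0.
Proof.
have [n [m ->]] : exists n m : nat, k = n%:Z - m%:Z.
  by case: k => n; [exists n, 0%N; rewrite subr0 | exists 0%N, n.+1; rewrite sub0r].
rewrite mulrzBr addrA => /eqP; rewrite subr_eq add0r => /eqP/(congr1 val).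
rewrite units_valD !units_valMn -!rmorphXn.
rewrite [val (laurent_const _)]/(laurent_poly (val u)%:P) -laurent_polyM.
move/laurent_poly_inj.
move/(congr1 (fun q : {poly R} => q`_m)); rewrite coefCM !coefXn eqxx.
have [-> | _] := eqVneq m n; last by rewrite mulr0 => /esym/eqP; rewrite oner_eq0.
by rewrite mulr1 subrr => u1; split=> //; apply: val_inj.
Qed.

Lemma presented_units_laurent m g :
  presented (units R) m g -> presented (units laurent) m (g + 1).
Proof.
exact: presented_extend units_laurent_decomp units_laurent_free.
Qed.

End Laurent.

(** Each Laurent extension raises the rank by one and keeps the characteristic, the constants being
    a subring. *)
Lemma exists_presented_units (R : idomainType) p m g :
    p \in [pchar R] -> presented (units R) m 0 ->
  exists R' : idomainType, p \in [pchar R'] /\ presented (units R') m g.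
Proof.
move=> pR Rm; elim: g => [|g [S [pS Sm]]]; first by exists R.
exists (laurent S); split; last by rewrite -addn1; apply: presented_units_laurent.
exact: (rmorph_pchar (@laurent_poly S \o polyC)).
Qed.

(** * Finite groups of units and torsion units *)

Definition torsion (A : zmodType) (x : A) :=
  exists2 n, (0 < n)%N & x *+ n = 0.

Lemma torsionD (A : zmodType) (x y : A) :
  torsion x -> torsion y -> torsion (x + y).
Proof.
move=> [m m0 xm] [n n0 yn]; exists (m * n)%N; first by rewrite muln_gt0 m0.
by rewrite mulrnDl mulrnA xm mul0rn mulnC mulrnA yn mul0rn addr0.
Qed.

(** By Cauchy's theorem a prime [l] dividing the size is the order of some element; that order
    divides [p], so [l = p]. *)
Lemma size_pchar_subgroup (V : zmodType) (p : nat) (s : seq V) :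
    prime p -> uniq s -> 0 \in s -> {in s &, forall x y, x - y \in s} ->
    {in s, forall x, x *+ p = 0} ->
  exists n, size s = (p ^ n)%N.
Proof.
move=> pr_p uniq_s s0 sB sp.
have sN x : x \in s -> - x \in s by move=> sx; rewrite -sub0r sB.
have sD x y : x \in s -> y \in s -> x + y \in s.
  by move=> sx sy; rewrite -[y]opprK sB ?sN.
pose zero := SeqSub s0.
pose opp (x : seq_sub s) := SeqSub (sN _ (ssvalP x)).
pose add (x y : seq_sub s) := SeqSub (sD _ _ (ssvalP x) (ssvalP y)).
have addA : associative add by move=> x y z; apply: val_inj; apply: addrA.
have addC : commutative add by move=> x y; apply: val_inj; apply: addrC.
have add0 : left_id zero add by move=> x; apply: val_inj; apply: add0r.
have addN : left_inverse zero opp add.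
  by move=> x; apply: val_inj; apply: addNr.
pose S : finZmodType :=
  HB.pack (seq_sub s) (GRing.isZmodule.Build _ addA addC add0 addN).
have valMn (x : S) n : ssval (x *+ n) = ssval x *+ n.
  by elim: n => // n IHn; rewrite !mulrS -IHn.
have cardS : #|[set: S]| = size s by rewrite cardsT card_seq_sub.
suff /p_natP[n sz_s] : p.-nat (size s) by exists n.
rewrite -cardS; apply/pnatP=> [|l pr_l /(Cauchy pr_l)[x _ ox]].
  by rewrite cardG_gt0.
have: (#[x]%g %| p)%N.
  rewrite order_dvdn; apply/eqP/val_inj.
  by rewrite FinRing.zmodXgE /= valMn sp ?ssvalP.
by rewrite ox dvdn_prime2.
Qed.

Section FiniteUnits.
Variable R : idomainType.
Implicit Types (u v : units R) (s : seq (units R)).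

(** In the fraction field, the [m] elements of [s] are distinct [m]-th roots of unity, so one of
    them is primitive; in characteristic [p] this excludes that [p] divides [m]. *)
Lemma finite_units_cyclic s :
    uniq s -> 0 \in s -> {in s &, forall u v, u + v \in s} ->
  exists a,
    [/\ forall k : int, a *~ k = 0 <-> (size s %| k)%Z,
        {in s, forall u, exists k, u = a *~ k}
      & forall p, p \in [pchar R] -> coprime p (size s)].
Proof.
move=> uniq_s s0 sD; set m := size s.
have m_gt0 : (0 < m)%N by rewrite /m; case: (s) s0.
(* Translation by [u] permutes [s]; comparing the sums over [s] before and after gives
   [u *+ m = 0]. *)
have order_s u : u \in s -> u *+ m = 0.
  move=> su; have inj_u : injective (+%R u) by apply: addrI.
  have [|||_ eq_us] := @uniq_min_size _ [seq u + v | v <- s] s.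
  - by rewrite map_inj_uniq.
  - by move=> _ /mapP[v sv ->]; apply: sD.
  - by rewrite size_map.
  have: \sum_(v <- [seq u + v | v <- s]) v = \sum_(v <- s) v.
    by apply/perm_big/uniq_perm; rewrite ?map_inj_uniq.
  rewrite big_map big_split /=.
  rewrite big_const_seq count_predT iter_addr_0 => /eqP.
  by rewrite -subr_eq0 addrK => /eqP.
pose emb u : {fraction R} := tofrac (val u).
have emb_inj : injective emb.
  by move=> u v /eqP; rewrite tofrac_eq => /eqP/val_inj.
have embMn u n : emb (u *+ n) = emb u ^+ n.
  by rewrite /emb units_valMn tofracXn.
have embE1 u : (emb u == 1) = (u == 0).
  by rewrite -tofrac1 -(inj_eq emb_inj).
have: has m.-primitive_root [seq emb u | u <- s].
  apply: has_prim_root => //; last by rewrite size_map.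
    apply/allP=> _ /mapP[u su ->]; apply/unity_rootP.
    by rewrite -embMn order_s // /emb tofrac1.
  by rewrite map_inj_uniq.
case/hasP=> _ /mapP[a sa ->] prim_a; exists a; split=> [k | u su | p pR].
- have aMn n : a *+ n = 0 <-> (m %| n)%N.
    rewrite (prim_order_dvd prim_a) -embMn embE1.
    by split=> [-> // | /eqP].
  rewrite dvdzE absz_nat; case: k => n; first exact: aMn.
  rewrite NegzE mulrNz abszN -aMn; split=> [/eqP | an].
    by rewrite oppr_eq0 => /eqP.
  by rewrite -pmulrn an oppr0.
- have [|i /eqP] := prim_rootP prim_a (_ : emb u ^+ m = 1).
    by rewrite -embMn order_s // /emb tofrac1.
  by rewrite -embMn (inj_eq emb_inj) => /eqP->; exists i%:Z.
have pr_p := pcharf_prime pR; rewrite prime_coprime //; apply/negP=> p_m.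
have pK : p \in [pchar {fraction R}] by apply: (rmorph_pchar (@tofrac R)).
by rewrite (prim_root_pcharF prim_a p_m) in pK.
Qed.

(* A unit is torsion iff it is fixed by a suitable power [x |-> x ^+ p ^ k] of
   the Frobenius endomorphism; as this map is additive, the torsion units and
   [0] form a subgroup of [R]. *)
Lemma size_torsion_units p s :
    p \in [pchar R] -> uniq s ->
    (forall u, u \in s <-> torsion u) ->
  exists2 n, (0 < n)%N & size s = (p ^ n).-1.
Proof.
move=> pR uniq_s sP; have pr_p := pcharf_prime pR.
have s0 : 0 \in s by apply/sP; exists 1%N.
have sD : {in s &, forall u v, u + v \in s}.
  by move=> u v /sP su /sP sv; apply/sP/torsionD.
have [a [ordera gena copm]] := finite_units_cyclic uniq_s s0 sD.
set m := size s in ordera copm.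
have m_gt0 : (0 < m)%N by rewrite /m; case: (s) s0.
(* By Euler's theorem [m] divides [q - 1], so every torsion unit satisfies [x ^+ q = x]. *)
pose q := (p ^ totient m)%N.
have q_gt1 : (1 < q)%N.
  by rewrite -(exp1n (totient m)) ltn_exp2r ?prime_gt1 ?totient_gt0.
have m_q : (m %| q.-1)%N.
  rewrite -subn1 -eqn_mod_dvd 1?ltnW //; apply/eqP/Euler_exp_totient.
  exact: copm.
pose F : seq R := 0 :: [seq val u | u <- s].
have uniq_F : uniq F.
  rewrite /= map_inj_uniq ?uniq_s ?andbT; last exact: val_inj.
  by apply/mapP=> -[u _ /esym u0]; have := units_valP u; rewrite u0 unitr0.
have FP x : (x \in F) = (x ^+ q == x).
  rewrite inE; have [->|x0] /= := eqVneq x 0.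
    by rewrite expr0n (gtn_eqF (ltnW q_gt1)) eqxx.
  rewrite -[q]prednK 1?ltnW // exprS -[eqbRHS]mulr1.
  rewrite (inj_eq (mulfI x0)); apply/mapP/eqP=> [[u su ->] | xq].
    suff ->: val u ^+ q.-1 = val (0 : units R) by [].
    have [k ->] := gena u su; rewrite -units_valMn pmulrn -mulrzA.
    by congr val; apply/ordera/dvdz_mull.
  (* Conversely, a nonzero [x] with [x ^+ q = x] has [x ^+ q.-1 = 1], hence is a torsion unit. *)
  have q1 : (0 < q.-1)%N by rewrite -subn1 subn_gt0.
  have ux : x \is a GRing.unit by rewrite -(unitrX_pos _ q1) xq unitr1.
  exists (Units ux) => //; apply/sP; exists q.-1 => //.
  by apply: val_inj; rewrite units_valMn.
have [|x y|x _|n sF] := size_pchar_subgroup pr_p uniq_F.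
- by rewrite inE eqxx.
- rewrite !FP => /eqP xq /eqP yq; rewrite exprDn_pchar ?exprNn_pchar ?xq ?yq //.
    by rewrite pnatX /= pnatE // pR.
  by rewrite pnatX /= pnatE // pR.
- by rewrite (mulrn_pchar pR).
have sz : (size s).+1 = (p ^ n)%N by rewrite -sF /= size_map.
exists n; last by rewrite -sz.
(* As [s] is nonempty, [p ^ n] is at least 2, which excludes [n = 0]. *)
by case: n sz {sF} => //; rewrite expn0 => -[]; move: m_gt0; rewrite /m => /[swap] ->.
Qed.

End FiniteUnits.

(** * Splitting off the torsion of a finitely generated abelian group *)

(* By the Smith normal form, a nontrivial relation becomes [w *~ e = 0] after a
   unimodular change of generators. *)
Lemma intcomb_relation (A : zmodType) g (z : 'I_g.+1 -> A) (c : 'rV_g.+1) :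
    c != 0 -> intcomb z c = 0 ->
  exists w (z' : 'I_g -> A), torsion w /\
    forall d, exists k d', intcomb z d = w *~ k + intcomb z' d'.
Proof.
move=> c0 zc; have [L _ [U uU [d _ cE]]] := int_Smith_normal_form c.
(* Since [c] is a single row, [L] is 1 by 1 and [LD] is [e] followed by zeros: [c] is [e] times the
   first row of [U]. *)
set LD := L *m _ in cE; pose e := L 0 0 * d`_0.
have LDE i : LD 0 i = e *+ (0 == i).
  by rewrite mxE big_ord1 mxE /e mulrnAr.
have e0 : e != 0.
  apply: contraNneq c0 => e0; rewrite cE (_ : LD = 0) ?mul0mx //.
  by apply/rowP=> i; rewrite LDE e0 mul0rn mxE.
have zU b : intcomb z (b *m U) = intcomb z (row 0 U) *~ b 0 0
    + intcomb (fun i => intcomb z (row (lift ord0 i) U)) (\row_i b 0 (lift ord0 i)).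
  rewrite intcomb_mulmx big_ord_recl; congr (_ + _).
  by apply: eq_bigr => i _; rewrite mxE.
exists (intcomb z (row 0 U)), (fun i => intcomb z (row (lift ord0 i) U)).
split=> [|b]; last first.
  by exists ((b *m invmx U) 0 0), (\row_i (b *m invmx U) 0 (lift ord0 i));
     rewrite -zU mulmxKV.
have /eqP we : intcomb z (row 0 U) *~ e == 0.
  move/eqP: zc; rewrite cE zU LDE (_ : \row_i _ = 0) ?intcomb0 ?addr0 //.
  by apply/rowP=> i; rewrite mxE LDE mxE.
exists `|e|%N; first by rewrite absz_gt0.
rewrite pmulrn abszE; have [e_ge0|e_lt0] := ger0P e; first by [].
by rewrite mulrNz we oppr0.
Qed.

(* [A] is the direct sum of its torsion subgroup, which is the finite set [s],
   and of the free group with basis [z]. *)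
Definition split_torsion (A : zmodType) :=
  exists (s : seq A) g (z : 'I_g -> A),
    [/\ forall x, exists2 y, y \in s & exists c, x = y + intcomb z c,
        forall c, intcomb z c = 0 -> c = 0,
        uniq s
      & forall x, x \in s <-> torsion x].

(** A torsion [x = y + intcomb z c] with [y] in [s0] makes a positive multiple of [c] a relation;
    freeness gives [c = 0], so [x = y]. *)
Lemma free_split_torsion (A : zmodType) (s0 : seq A) g (z : 'I_g -> A) :
    (forall x, exists2 y, y \in s0 & exists c, x = y + intcomb z c) ->
    {in s0, forall x, torsion x} ->
    (forall c, intcomb z c = 0 -> c = 0) ->
  split_torsion A.
Proof.
move=> gens tors freez; exists (undup s0), g, z; split; rewrite ?undup_uniq //.
  by move=> x; have [y sy yP] := gens x; exists y; rewrite ?mem_undup.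
move=> x; rewrite mem_undup; split=> [/tors // | [n n0 xn]].
have [y sy [c xE]] := gens x; have [m m0 ym] := tors y sy.
suff c0 : c = 0 by rewrite xE c0 intcomb0 addr0.
have /freez/rowP cmn : intcomb z (c *+ (m * n)) = 0.
  have -> : intcomb z (c *+ (m * n)) = (x - y) *+ (m * n).
    by rewrite xE addrC addKr intcombMn.
  rewrite mulrnBl [in X in _ - X]mulrnA ym mul0rn.
    by rewrite mulnC mulrnA xn mul0rn subr0.
apply/rowP=> i; apply/eqP; have /eqP := cmn i.
by rewrite mulmxnE !mxE mulrn_eq0 muln_eq0 !gtn_eqF.
Qed.

(** Induction on the number of generators, modulo a finite list [s] of torsion elements. A
    nontrivial relation turns one generator into a torsion element, which is absorbed into [s]. *)
Lemma fin_gen_split_torsion (A : zmodType) :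
  fin_gen A -> split_torsion A.
Proof.
move=> [g [z genz]].
have: exists s : seq A,
    (forall x, exists2 y, y \in s & exists c, x = y + intcomb z c) /\
    {in s, forall x, torsion x}.
  exists [:: 0]; split=> [x | x /[!inE]/eqP->]; last by exists 1%N.
  exists 0; rewrite ?inE //; have [c ->] := genz x; exists (\row_i c i).
  by rewrite add0r; apply: eq_bigr => i _; rewrite mxE.
elim: g z {genz} => [|g IHg] z [s [gens tors]];
  have [freez|] := pselect (forall c, intcomb z c = 0 -> c = 0).
- exact: free_split_torsion gens tors freez.
- by case=> c _; apply/rowP; case.
- exact: free_split_torsion gens tors freez.
move=> /existsNP[c /not_implyP[zc /eqP c0]].
have [w [z' [torw genw]]] := intcomb_relation c0 zc; have [n n0 wn] := torw.
(* As [n] kills [w], coefficients of [w] matter only modulo [n], so finitely many multiples of [w]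
   suffice. *)
apply: (IHg z'); exists [seq y + w *+ i | y <- s, i <- iota 0 n]; split=> x.
  have [y sy [d ->]] := gens x; have [k [d' ->]] := genw d.
  exists (y + w *~ (k %% n)%Z); last first.
    exists d'; rewrite addrA {1}(divz_eq k n) mulrzDr mulrC mulrzA.
    by rewrite -[w *~ n]pmulrn wn mul0rz add0r.
  have n0' : n%:Z != 0 by case: (n) n0.
  have := modz_ge0 k n0'; have := ltz_pmod k (n0 : 0 < n%:Z).
  case: (k %% n)%Z => // i lt_in _.
  by rewrite -pmulrn; apply: allpairs_f; rewrite ?mem_iota.
case/allpairsP=> -[y i] [/= /tors tory _ ->]; apply: torsionD tory _.
by exists n; rewrite // mulrnAC wn mul0rn.
Qed.

(** * Presentations of the unit groups and the classification *)

Lemma fin_gen_units_presented (R : idomainType) p :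
    p \in [pchar R] -> fin_gen (units R) ->
  exists n g, (0 < n)%N /\ presented (units R) (p ^ n).-1 g.
Proof.
move=> pR /fin_gen_split_torsion[s [g [z [genz freez uniq_s sP]]]].
have [n n0 sz_s] := size_torsion_units pR uniq_s sP.
have s0 : 0 \in s by apply/sP; exists 1%N.
have sD : {in s &, forall u v, u + v \in s}.
  by move=> u v /sP su /sP sv; apply/sP/torsionD.
have [a [ordera gena _]] := finite_units_cyclic uniq_s s0 sD.
exists n, g; split=> //; rewrite -sz_s; exists a, z; split=> [u | k c].
  by have [v /gena[k ->] [c ->]] := genz u; exists (k, c).
split=> [akc | [/ordera-> ->]]; last by rewrite intcomb0 addr0.
have m0 : (0 < size s)%N by case: (s) s0.
have am : a *+ size s = 0 by apply/(ordera (size s)).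
suff c0 : c = 0 by move: akc; rewrite c0 intcomb0 addr0 => /ordera.
(* Multiplying the relation by [size s] kills the part in [a], leaving a relation on the free
   family. *)
have /freez/rowP cm : intcomb z (c *+ size s) = 0.
  rewrite intcombMn -[intcomb z c](addKr (a *~ k)) akc addr0 mulNrn.
  by rewrite pmulrn mulrzAC -pmulrn am mul0rz oppr0.
apply/rowP=> i; apply/eqP; have /eqP := cm i.
by rewrite mulmxnE !mxE mulrn_eq0 gtn_eqF.
Qed.

Lemma presented_units_finField (F : finFieldType) :
  presented (units F) #|F|.-1 0.
Proof.
pose s : seq (units F) := pmap insub (enum F).
have sE u : u \in s by rewrite mem_pmap_sub mem_enum.
have uniq_s : uniq s by apply/pmap_sub_uniq/enum_uniq.
have sz_s : size s = #|F|.-1.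
  rewrite size_pmap_sub -(cardC1 (0 : F)) cardE /enum_mem size_filter count_filter.
  by apply: eq_count => x; rewrite !inE andbT unitfE.
have [//|//|a [ordera gena _]] := @finite_units_cyclic _ s uniq_s.
rewrite -sz_s; exists a, (fun=> 0); split=> [u | k c].
  by have [k ->] := gena u (sE u); exists (k, 0); rewrite intcomb0 addr0.
by rewrite [c]thinmx0 intcomb0 addr0 ordera; split=> [|[]].
Qed.

Theorem theorem3p4 (p : nat) (pr_p : prime p) (A : zmodType) :
  (fin_gen A /\
     exists R : idomainType, p \in [pchar R] /\ isomorphic A (units R))
  <->
  (exists (n : nat) (n_gt0 : (0 < n)%N) (g : nat),
     isomorphic A (units (Fpn pr_p n_gt0) * 'rV[int]_g)%type).
Proof.
have FpnP n (n_gt0 : (0 < n)%N) :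
    p \in [pchar Fpn pr_p n_gt0] /\ presented (units (Fpn pr_p n_gt0)) (p ^ n).-1 0.
  have := presented_units_finField (Fpn pr_p n_gt0).
  by rewrite /Fpn; case: pPrimePowerField => F pF /= ->.
split=> [[[k [s gens]] [R [pR isoAR]]] | [n [n_gt0 [g isoA]]]].
  have [f [h fK hK]] := isoAR.
  have fgR : fin_gen (units R).
    exists k, (f \o s) => y; have [c hy] := gens (h y); exists c.
    rewrite -[y]hK hy raddf_sum; apply: eq_bigr => i _; exact: raddfMz.
  have [n [g [n_gt0 presR]]] := fin_gen_units_presented pR fgR.
  exists n, n_gt0, g; apply: (@presented_isomorphic _ _ (p ^ n).-1 g).
    exact: isomorphic_presented isoAR presR.
  exact: presented_prod_free (FpnP n n_gt0).2.
have presA := isomorphic_presented isoA (presented_prod_free g (FpnP n n_gt0).2).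
split; first exact: presented_fin_gen presA.
have [R [pR presR]] := exists_presented_units g (FpnP n n_gt0).1 (FpnP n n_gt0).2.
by exists R; split=> //; apply: presented_isomorphic presA presR.
Qed.
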